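(* Let $G=\mathrm{U}(1)\ltimes\mathbb{C}$ act on $\mathbb{C}$ by $[a,b]\cdot z=az+b$. Let $\tilde\rho:\mathrm{U}(1)\to\mathrm{U}(1)$, $\tilde\tau:\mathbb{C}\to\mathbb{C}$ and $\tau:\mathbb{C}\to\mathbb{C}$ be maps, let $\rho=\tilde\rho\ltimes\tilde\tau:G\to G$ be defined by $\rho([a,b])=[\tilde\rho(a),\tilde\tau(b)]$, and assume that $(\rho,\tau)$ is a $G$-equivariant pair. Then one of the following two cases holds: (1) $\tilde\rho$ is a group endomorphism of $\mathrm{U}(1)$, $\tilde\tau$ is additive and satisfies $\tilde\tau(ab+c)=\tilde\rho(a)\tilde\tau(b)+\tilde\tau(c)$ for all $a\in\mathrm{U}(1)$ and $b,c\in\mathbb{C}$, and $\tau(z)=\tilde\tau(z)$ for all $z\in\mathbb{C}$; (2) $\tilde\rho\equiv1$, $\tilde\tau$ is additive and satisfies $\tilde\tau(ab+c)=\tilde\tau(b)+\tilde\tau(c)$ for all $a\in\mathrm{U}(1)$ and $b,c\in\mathbb{C}$, and there is $\beta\in\mathbb{C}$ such that $\tau(z)=\tilde\tau(z)+\beta$ for all $z\in\mathbb{C}$.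
   Context: $G=\mathrm{U}(1)\ltimes\mathbb{C}$ is the group of matrices $[a,b]:=\begin{pmatrix}a&b\\0&1\end{pmatrix}$ with $|a|=1$, $b\in\mathbb{C}$, so that $[a,b][a',b']=[aa',ab'+b]$. A pair $(\rho,\tau)$ is a $G$-equivariant pair if $\rho:G\to G$ is a group endomorphism and $\tau:\mathbb{C}\to\mathbb{C}$ is a map such that $\tau(g\cdot z)=\rho(g)\cdot\tau(z)$ for all $g\in G$, $z\in\mathbb{C}$. *)

(* Defs.v *)
From HB Require Import structures.
From mathcomp Require Import all_boot all_order all_algebra complex reals.

Set Implicit Arguments.
Unset Strict Implicit.
Unset Printing Implicit Defensive.

Import GRing.Theory Num.Theory.
Local Open Scope ring_scope.

(* Group homomorphisms are only required to preserve products; preservation of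
   1 and of inverses follows. *)
Definition group_endomorphism (G : groupType) (f : G -> G) : Prop :=
  {morph f : x y / (x * y)%g}.

Definition unit_complex (R : realType) (a : R[i]) : bool := `|a| == 1.

Record U1 (R : realType) : Type :=
  MkU1 { U1val :> R[i]; U1valP : unit_complex U1val }.

HB.instance Definition _ (R : realType) := [isSub for @U1val R].
HB.instance Definition _ (R : realType) := [Choice of U1 R by <:].

Section U1Group.
Variable R : realType.
Implicit Types a b c : U1 R.

Lemma U1_norm a : `|a : R[i]| = 1.
Proof. by apply/eqP; exact: U1valP. Qed.

Lemma U1_neq0 a : (a : R[i]) != 0.
Proof. by rewrite -normr_gt0 U1_norm ltr01. Qed.

Lemma U1_one_subproof : unit_complex (1 : R[i]).
Proof. by rewrite /unit_complex normr1. Qed.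

Lemma U1_mul_subproof a b : unit_complex ((a : R[i]) * (b : R[i])).
Proof. by rewrite /unit_complex normrM !U1_norm mulr1. Qed.

Lemma U1_inv_subproof a : unit_complex (a : R[i])^-1.
Proof. by rewrite /unit_complex normfV U1_norm invr1. Qed.

Definition U1one : U1 R := MkU1 U1_one_subproof.
Definition U1mul a b : U1 R := MkU1 (U1_mul_subproof a b).
Definition U1inv a : U1 R := MkU1 (U1_inv_subproof a).

Lemma U1mulA : associative U1mul.
Proof. by move=> a b c; apply: val_inj; rewrite /= mulrA. Qed.

Lemma U1mul1 : left_id U1one U1mul.
Proof. by move=> a; apply: val_inj; rewrite /= mul1r. Qed.

Lemma U1mulr1 : right_id U1one U1mul.
Proof. by move=> a; apply: val_inj; rewrite /= mulr1. Qed.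

Lemma U1mulV : left_inverse U1one U1inv U1mul.
Proof. by move=> a; apply: val_inj; rewrite /= mulVf ?U1_neq0. Qed.

Lemma U1mulrV : right_inverse U1one U1inv U1mul.
Proof. by move=> a; apply: val_inj; rewrite /= mulfV ?U1_neq0. Qed.

End U1Group.

HB.instance Definition _ (R : realType) :=
  isGroup.Build (U1 R) (@U1mulA R) (@U1mul1 R) (@U1mulr1 R) (@U1mulV R)
    (@U1mulrV R).

Definition affine_mx (R : realType) (a b : R[i]) : 'M[R[i]]_2 :=
  \matrix_(i, j) if i == 0 then (if j == 0 then a else b)
                 else (if j == 0 then 0 else 1).

Definition motion_mx (R : realType) (M : 'M[R[i]]_2) : bool :=
  (M == affine_mx (M 0 0) (M 0 1)) && unit_complex (M 0 0).

(* The semidirect product of U(1) and C, as a group of matrices. *)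
Record motion (R : realType) : Type :=
  MkMotion { motion_val :> 'M[R[i]]_2; motion_valP : motion_mx motion_val }.

HB.instance Definition _ (R : realType) := [isSub for @motion_val R].
HB.instance Definition _ (R : realType) := [Choice of motion R by <:].

Section MotionGroup.
Variable R : realType.
Implicit Types (a : U1 R) (b z : R[i]) (g h : motion R).

Lemma affine_mxE (x b : R[i]) :
  (affine_mx x b 0 0 = x) * (affine_mx x b 0 1 = b)
  * (affine_mx x b 1 0 = 0) * (affine_mx x b 1 1 = 1).
Proof. by rewrite !mxE. Qed.

Lemma affine_mx_mul (x b x' b' : R[i]) :
  affine_mx x b *m affine_mx x' b' = affine_mx (x * x') (x * b' + b).
Proof.
apply/matrixP=> i j; rewrite !mxE !big_ord_recl big_ord0 !mxE /= addr0.
by case: (i == 0); case: (j == 0);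
  rewrite ?mulr0 ?mul0r ?mulr1 ?mul1r ?addr0 ?add0r.
Qed.

Lemma affine_mx1 : affine_mx 1 0 = 1%:M :> 'M[R[i]]_2.
Proof.
by apply/matrixP=> -[[|[|[]]] //= ?] [[|[|[]]] //= ?]; rewrite !mxE.
Qed.

Lemma affine_subproof a b : motion_mx (affine_mx a b).
Proof. by rewrite /motion_mx !affine_mxE eqxx U1valP. Qed.

Definition affine a b : motion R := MkMotion (affine_subproof a b).

Lemma affineP g : exists a b, g = affine a b.
Proof.
case: g => M pM; have /andP[/eqP eM uM] := pM.
by exists (MkU1 uM), (M 0 1); apply: val_inj.
Qed.

Lemma affine_inj a b a' b' : affine a b = affine a' b' -> a = a' /\ b = b'.
Proof.
move/(congr1 (@motion_val R)) => /= E; split; first apply: val_inj => /=.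
  by rewrite -[LHS](affine_mxE (U1val a) b).1.1.1 E !affine_mxE.
by rewrite -[LHS](affine_mxE (U1val a) b).1.1.2 E !affine_mxE.
Qed.

Lemma motion_one_subproof : motion_mx (1%:M : 'M[R[i]]_2).
Proof. by rewrite -affine_mx1; exact: (affine_subproof (U1one R)). Qed.

Lemma motion_mul_subproof g h : motion_mx (motion_val g *m motion_val h).
Proof.
have [a [b ->]] := affineP g; have [a' [b' ->]] := affineP h.
by rewrite /= affine_mx_mul; exact: (affine_subproof (a * a')%g).
Qed.

Lemma affine_mx_inv a b :
  invmx (affine_mx a b) = affine_mx (a : R[i])^-1 (- ((a : R[i])^-1 * b)).
Proof.
have E : affine_mx (a : R[i])^-1 (- ((a : R[i])^-1 * b)) *m affine_mx a b = 1%:M.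
  by rewrite affine_mx_mul mulVf ?U1_neq0// subrr affine_mx1.
have [_ U] := mulmx1_unit E.
by rewrite -[LHS]mul1mx -E -mulmxA mulmxV// mulmx1.
Qed.

Lemma motion_unit g : motion_val g \in unitmx.
Proof.
have [a [b ->]] := affineP g.
have E : affine_mx (a : R[i])^-1 (- ((a : R[i])^-1 * b)) *m affine_mx a b = 1%:M.
  by rewrite affine_mx_mul mulVf ?U1_neq0// subrr affine_mx1.
by have [] := mulmx1_unit E.
Qed.

Lemma motion_inv_subproof g : motion_mx (invmx (motion_val g)).
Proof.
have [a [b ->]] := affineP g.
by rewrite /= affine_mx_inv; exact: (affine_subproof (a^-1)%g).
Qed.

Definition motion_one : motion R := MkMotion motion_one_subproof.
Definition motion_mul g h : motion R := MkMotion (motion_mul_subproof g h).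
Definition motion_inv g : motion R := MkMotion (motion_inv_subproof g).

Lemma motion_mulA : associative motion_mul.
Proof. by move=> g h k; apply: val_inj; rewrite /= mulmxA. Qed.

Lemma motion_mul1 : left_id motion_one motion_mul.
Proof. by move=> g; apply: val_inj; rewrite /= mul1mx. Qed.

Lemma motion_mulr1 : right_id motion_one motion_mul.
Proof. by move=> g; apply: val_inj; rewrite /= mulmx1. Qed.

Lemma motion_mulV : left_inverse motion_one motion_inv motion_mul.
Proof. by move=> g; apply: val_inj; rewrite /= mulVmx ?motion_unit. Qed.

Lemma motion_mulrV : right_inverse motion_one motion_inv motion_mul.
Proof. by move=> g; apply: val_inj; rewrite /= mulmxV ?motion_unit. Qed.

End MotionGroup.

HB.instance Definition _ (R : realType) :=
  isGroup.Build (motion R) (@motion_mulA R) (@motion_mul1 R) (@motion_mulr1 R)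
    (@motion_mulV R) (@motion_mulrV R).

Lemma affineM (R : realType) (a a' : U1 R) (b b' : R[i]) :
  (affine a b * affine a' b')%g = affine (a * a')%g ((a : R[i]) * b' + b).
Proof. by apply: val_inj; rewrite /= affine_mx_mul. Qed.

Definition motion_act (R : realType) (g : motion R) (z : R[i]) : R[i] :=
  motion_val g 0 0 * z + motion_val g 0 1.

Lemma motion_act_affine (R : realType) (a : U1 R) (b z : R[i]) :
  motion_act (affine a b) z = (a : R[i]) * z + b.
Proof. by rewrite /motion_act /= !affine_mxE. Qed.

Definition equivariant_pair (R : realType) (rho : motion R -> motion R)
    (tau : R[i] -> R[i]) : Prop :=
  group_endomorphism rho /\
  forall (g : motion R) (z : R[i]),
    tau (motion_act g z) = motion_act (rho g) (tau z).

(* Main.v *)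
Require Import Defs.
From mathcomp Require Import all_boot all_order all_algebra complex reals.

Import GRing.Theory.
Local Open Scope ring_scope.

(** Since [[a,b]] sends 0 to [b], equivariance at 0 gives [tau b = rhot a * tau 0 + taut b] for
    every [a]. The left side does not depend on [a], so each [rhot a] fixes [tau 0]: either
    [tau 0 = 0] and [tau = taut], or [rhot] is trivial and [beta = tau 0]. The laws for [rhot] and
    [taut] are the two components of multiplicativity of [rho]. *)

Theorem theorem2p6 (R : realType)
    (rhot : U1 R -> U1 R) (taut tau : R[i] -> R[i])
    (rho : motion R -> motion R)
    (rhoE : forall (a : U1 R) (b : R[i]),
       rho (affine a b) = affine (rhot a) (taut b))
    (equiv : equivariant_pair rho tau) :
  [/\ group_endomorphism rhot,
      {morph taut : x y / x + y},
      forall (a : U1 R) (b c : R[i]),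
        taut (U1val a * b + c) = U1val (rhot a) * taut b + taut c
    & forall z : R[i], tau z = taut z]
  \/
  [/\ forall a : U1 R, rhot a = 1%g,
      {morph taut : x y / x + y},
      forall (a : U1 R) (b c : R[i]),
        taut (U1val a * b + c) = taut b + taut c
    & exists beta : R[i], forall z : R[i], tau z = taut z + beta].
Proof.
have [rhoM rho_tau] := equiv.
have rhoE2 a b a' b' : rhot (a * a')%g = (rhot a * rhot a')%g
    /\ taut (U1val a * b' + b) = U1val (rhot a) * taut b' + taut b.
  by apply: affine_inj; rewrite -affineM -!rhoE -rhoM affineM.
have rhotM : group_endomorphism rhot by move=> a a'; have [] := rhoE2 a 0 a' 0.
have tautM a b c : taut (U1val a * b + c) = U1val (rhot a) * taut b + taut c.
  by have [] := rhoE2 a c a b.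
have rhot1 : rhot 1%g = 1%g.
  (* An idempotent of a group is the identity. *)
  by apply: (mulgI (rhot 1%g)); rewrite -rhotM !mulg1.
have tautD : {morph taut : x y / x + y}.
  (* Additivity is the twisted law at trivial rotation. *)
  by move=> x y; have := tautM 1%g x y; rewrite rhot1 !mul1r.
have tauE a b : tau b = U1val (rhot a) * tau 0 + taut b.
  have := rho_tau (affine a b) 0.
  by rewrite rhoE !motion_act_affine mulr0 add0r.
have tauE1 b : tau b = taut b + tau 0.
  by rewrite (tauE 1%g) rhot1 mul1r addrC.
(* tau 0 is fixed by every rhot a, hence is 0 unless rhot is trivial. *)
have tau0_fixed a : U1val (rhot a) * tau 0 = tau 0.
  by apply: (addIr (taut 0)); rewrite -tauE addrC -tauE1.
have [tau0|tau0_neq0] := eqVneq (tau 0) 0.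
  by left; split=> // z; rewrite tauE1 tau0 addr0.
have rhot_triv a : rhot a = 1%g.
  (* Cancel the nonzero [tau 0] in the field. *)
  by apply/val_inj/(mulIf tau0_neq0); rewrite /= tau0_fixed mul1r.
right; split=> //; last by exists (tau 0).
by move=> a b c; rewrite tautM rhot_triv mul1r.
Qed.
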